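(* Suppose $G$ is a double-arborescence on $n$ vertices with clique number $k$. Then $\ell(G)=2n-k$.
   Context: A treelike comparability graph is a graph admitting a transitive orientation whose Hasse diagram (transitive reduction), as an undirected graph, is a tree. A double-arborescence is a treelike comparability graph $G=(V,E)$ with a vertex $r$ such that $V=\{r\}\cup N_G(r)$. A word over a finite alphabet is a finite sequence of letters. Letters $a,b$ alternate in a word $w$ if the subsequence of $w$ consisting of all occurrences of $a$ and $b$ is of the form $abab\cdots$ or $baba\cdots$ (of even or odd length). A graph $G=(V,E)$ is word-representable if there is a word $w$ over $V$ (a word-representant) such that for all $a,b\in V$, $a$ and $b$ are adjacent iff they alternate in $w$. $\ell(G)$ denotes the minimum length of a word-representant of $G$ (double-arborescences are word-representable). The clique number is the size of a largest complete subgraph. *)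

(* Defs.v *)
From mathcomp Require Export all_boot.

Set Implicit Arguments.
Unset Strict Implicit.
Unset Printing Implicit Defensive.

Section Graphs.
Variable T : finType.
Implicit Types e d h : rel T.

Definition simple_graph e : Prop := symmetric e /\ irreflexive e.

Definition clique e (A : {set T}) : bool :=
  [forall x in A, forall y in A, (x != y) ==> e x y].

Definition clique_number e : nat := \max_(A : {set T} | clique e A) #|A|.

Definition connected h : Prop := forall x y, connect h x y.

(* MathComp's [ucycle h] also holds of the sequences [:: x; y] with [h x y],
   which are edges rather than graph cycles when [h] is symmetric. *)
Definition acyclic h : Prop := forall c : seq T, 2 < size c -> ~ ucycle h c.

Definition is_tree h : Prop := [/\ 0 < #|T|, connected h & acyclic h].

Definition transitive_orientation e d : Prop :=
  [/\ forall x y, e x y = d x y || d y x,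
      forall x y, ~~ (d x y && d y x)
    & transitive d].

Definition covers d : rel T :=
  [rel x y | d x y && ~~ [exists z, d x z && d z y]].

Definition hasse d : rel T := [rel x y | covers d x y || covers d y x].

Definition treelike_comparability e : Prop :=
  exists2 d, transitive_orientation e d & is_tree (hasse d).

Definition neighbours e (r : T) : {set T} := [set v | e r v].

Definition double_arborescence e : Prop :=
  treelike_comparability e /\ exists r : T, [set: T] = r |: neighbours e r.

(* [:: a; b; a; b; ...] with [m] letters. *)
Definition alternating (a b : T) (m : nat) : seq T :=
  mkseq (fun i => if odd i then b else a) m.

Definition alternate (a b : T) (w : seq T) : bool :=
  let s := [seq x <- w | x \in [:: a; b]] in
  (s == alternating a b (size s)) || (s == alternating b a (size s)).

(* A representant contains every vertex at least once, as is standard for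
   word-representants. Adjacency is only compared on distinct letters. *)
Definition word_representant e (w : seq T) : Prop :=
  (forall a, a \in w) /\ forall a b, a != b -> e a b = alternate a b w.

(* [l] is the minimum length of a word-representant; in particular one exists. *)
Definition min_representant_length e (l : nat) : Prop :=
  (exists2 w, word_representant e w & size w = l) /\
  forall w, word_representant e w -> l <= size w.

End Graphs.

(* Main.v *)
(** A letter occurring only once alternates with every other such letter, so
    these letters form a clique: a word-representant has length at least [2n-k].

    Conversely let [r] be the universal vertex, [U] the vertices [v >= r], [D]
    the vertices [v < r], and [K] a maximum clique. Since the Hasse diagram is
    acyclic, the elements of [U] below a given one form a chain, so [U] is a
    forest, and [K] is downward closed in it. Peeling off a root [a] (in [K] as
    long as possible) with the set [A1] of its descendants, the rest being [B],
    put
      [X1 = a X1(A1) X1(B)] (without [a] if [a] is in [K]), and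
      [X2 = X2(B) a X2(A1)].
    Then [X1 ++ X2] represents [U], with the letters of [K] occurring only in
    [X2]. With [Y1], [Y2] the analogous words for [D] under the reversed order,
    [X1 ++ rev Y2 ++ X2 ++ rev Y1] represents the graph: letters [x] of [U] and
    [y] of [D] appear as [xyxy], where the first [x] or the last [y] may be
    missing. *)

Require Import Defs.
From mathcomp Require Import all_boot.

Set Implicit Arguments.
Unset Strict Implicit.
Unset Printing Implicit Defensive.

(** * Alternation of two letters as absence of equal neighbours *)

Section Alternation.
Variable T : finType.
Implicit Types (a b x y : T) (s w : seq T).

Definition restr a b w := [seq x <- w | x \in [:: a; b]].

Lemma restrC a b w : restr a b w = restr b a w.
Proof. by apply: eq_filter => x; rewrite !inE orbC. Qed.

Lemma restr_cat a b w1 w2 : restr a b (w1 ++ w2) = restr a b w1 ++ restr a b w2.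
Proof. exact: filter_cat. Qed.

Lemma restr_rev a b w : restr a b (rev w) = rev (restr a b w).
Proof. exact: filter_rev. Qed.

Lemma restr_nil a b w : a \notin w -> b \notin w -> restr a b w = [::].
Proof.
move=> aw bw; apply/eqP; rewrite -size_eq0 size_filter -leqn0 leqNgt -has_count.
apply/hasPn => x xw; rewrite !inE negb_or.
by rewrite (memPn aw x xw) (memPn bw x xw).
Qed.

Lemma restr_single a b w :
  uniq w -> b \notin w -> restr a b w = if a \in w then [:: a] else [::].
Proof.
move=> uw bw; case: ifPn => aw; last exact: restr_nil.
rewrite -(filter_pred1_uniq uw aw); apply: eq_in_filter => x xw.
by rewrite !inE (negPf (memPn bw x xw)) orbF.
Qed.

Lemma alternatingS a b m :
  alternating a b m.+1 = a :: alternating b a m.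
Proof.
rewrite /alternating /mkseq /= (iotaDl 1 0) -map_comp; congr cons.
by apply: eq_map => i /=; case: (odd i).
Qed.

(** The seed [b] of the path forces the first letter to be [a]; from then on, differing from the
    predecessor leaves one choice for each letter. *)
Lemma eq_alternating a b s : a != b -> all (mem [:: a; b]) s ->
  (s == alternating a b (size s)) = path (fun x y => x != y) b s.
Proof.
elim: s a b => // x s IHs a b neq_ab /= /andP[xab sab].
rewrite alternatingS eqseq_cons; move: xab; rewrite !inE.
have sba: all (mem [:: b; a]) s.
  by apply: sub_all sab => y; rewrite !inE orbC.
case/orP => /eqP ->; first by rewrite eqxx (eq_sym b) neq_ab IHs // eq_sym.
by rewrite eqxx eq_sym (negPf neq_ab).
Qed.

(** The first remaining letter selects one of the two patterns. The resulting local condition can be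
    checked piecewise on concatenations. *)
Lemma alternateE a b w : a != b ->
  alternate a b w = sorted (fun x y => x != y) (restr a b w).
Proof.
move=> neq_ab; rewrite /alternate /= -/(restr a b w).
have: all (mem [:: a; b]) (restr a b w) by exact: filter_all.
move: (restr a b w) => s sab.
have sba: all (mem [:: b; a]) s.
  by apply: sub_all sab => y; rewrite !inE orbC.
rewrite !eq_alternating // 1?eq_sym //.
case: s sab {sba} => //= x s /andP[]; rewrite !inE.
by case/orP => /eqP -> _; rewrite !eqxx /= ?(eq_sym b) neq_ab ?orbF.
Qed.

Lemma alternateC a b w : alternate a b w = alternate b a w.
Proof.
by rewrite /alternate /= -!/(restr _ _ _) restrC orbC.
Qed.

Lemma alternate_rev a b w : a != b -> alternate a b (rev w) = alternate a b w.
Proof.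
move=> neq_ab; rewrite !alternateE // restr_rev rev_sorted.
by case: (restr a b w) => //= x s; apply: eq_path => y z; rewrite eq_sym.
Qed.

Lemma alternate_once a b w : a != b ->
  count_mem a w = 1 -> count_mem b w = 1 -> alternate a b w.
Proof.
move=> neq_ab ca cb; rewrite alternateE //.
have: uniq (restr a b w).
  apply/count_mem_uniq => x; rewrite count_filter mem_filter.
  have [xab /=|xNab /=] := boolP (x \in [:: a; b]); last first.
    rewrite -(count_pred0 w); apply: eq_count => y /=.
    by case: eqP => [->|//]; rewrite (negPf xNab).
  have ->: count (predI (pred1 x) (mem [:: a; b])) w = count_mem x w.
    by apply: eq_count => y /=; case: eqP => [->|//]; rewrite xab.
  have c1: count_mem x w = 1 by move: xab; rewrite !inE => /orP[] /eqP ->.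
  by rewrite c1 -has_pred1 has_count c1.
case: (restr a b w) => //= x s.
elim: s x => //= y s IHs x /and3P[]; rewrite inE negb_or => /andP[-> _] ys us.
by rewrite IHs //= ys.
Qed.

End Alternation.

(** * Lower bound from the letters occurring once *)

Section LowerBound.
Variables (T : finType) (e : rel T).

Lemma clique_leq (A : {set T}) : clique e A -> #|A| <= clique_number e.
Proof. by move=> cA; apply: leq_bigmax_cond. Qed.

Lemma clique_number_witness : exists2 A, clique e A & #|A| = clique_number e.
Proof.
have c0: clique e set0 by apply/forall_inP => x; rewrite inE.
have: 0 < #|[pred A | clique e A]| by apply/card_gt0P; exists set0.
by case/(eq_bigmax_cond (fun A : {set T} => #|A|)) => A cA eqA; exists A.
Qed.

Lemma representant_size w :
  word_representant e w -> 2 * #|T| - clique_number e <= size w.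
Proof.
case=> w_all w_alt; pose S := [set a | count_mem a w == 1].
have cS: clique e S.
  apply/forall_inP => a; rewrite inE => /eqP ca; apply/forall_inP => b.
  rewrite inE => /eqP cb; apply/implyP => neq_ab.
  by rewrite w_alt // alternate_once.
have leS := clique_leq cS.
have ->: size w = \sum_a count_mem a w.
  rewrite -sum1_size (partition_big id xpredT) //=.
  by apply: eq_bigr => a _; rewrite -sum1_count; apply: eq_bigl => b.
(* Every letter adds at least 2 to [#|S| + size w]: a letter occurring only once is counted again in
   [S]. *)
rewrite leq_subLR; apply: leq_trans (leq_add leS (leqnn _)).
rewrite -sum1_card big_mkcond -big_split /= mulnC -sum_nat_const.
apply: leq_sum => a _; rewrite inE.
have: 0 < count_mem a w by rewrite -has_count has_pred1.
by case: (count_mem a w) => [|[|c]].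
Qed.

End LowerBound.

(** * Words representing a forest order *)

Section Forest.
Variables (T : finType) (d : rel T).
Hypotheses (d_irr : irreflexive d) (d_tr : transitive d).
Implicit Types (A K : {set T}) (x y z : T).

(** Take an element of [A] with the fewest predecessors in [T]: a predecessor of it in [A] would
    have strictly fewer. *)
Lemma minimal_elt A : A != set0 ->
  exists2 a, a \in A & {in A, forall x, ~~ d x a}.
Proof.
case/set0Pn => a0 a0A.
case: (arg_minnP (fun a => #|[set x | d x a]|) a0A) => a aA mina.
exists a => // x xA; apply/negP => xa.
have /= := mina x xA; rewrite leqNgt => /negP[]; apply: proper_card.
apply/properP; split.
  by apply/subsetP => y; rewrite !inE => /d_tr; apply.
by exists x; rewrite !inE ?d_irr.
Qed.

(** Induction on [#|A|]. The chain [K] may reach outside [A], so the same [K] serves for both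
    subsets in the recursion. *)
Lemma forest_words K A :
  {in A & &, forall x y z, d x z -> d y z -> [|| x == y, d x y | d y x]} ->
  {in K &, forall x y, [|| x == y, d x y | d y x]} ->
  {in A & K, forall x c, d x c -> x \in K} ->
  exists X1 X2, [/\ uniq X1, uniq X2, X1 =i A :\: K, X2 =i A &
    {in A &, forall x y, x != y ->
       alternate x y (X1 ++ X2) = d x y || d y x}].
Proof.
move=> + K_chain; have [n] := ubnP #|A|; elim: n A => // n IHn A.
rewrite ltnS => leAn forestA K_low.
have [->|A_n0] := eqVneq A set0.
  by exists [::], [::]; split=> // x; rewrite !inE ?andbF.
(* If [K] meets [A], a minimal element of [A :&: K] is minimal in [A], since [K] is downward closed
   there. Otherwise any minimal element of [A] will do. *)
have [a [aA a_min aK]] : exists a, [/\ a \in A, {in A, forall x, ~~ d x a} &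
    a \notin K -> {in A, forall x, x \notin K}].
  have [AK0|/minimal_elt[a]] := eqVneq (A :&: K) set0.
    have [a aA a_min] := minimal_elt A_n0; exists a; split=> // _ x xA.
    apply/negP => xK; have: x \in A :&: K by rewrite inE xA.
    by rewrite AK0 inE.
  rewrite inE => /andP[aA aK] a_min; exists a; split=> // [x xA|]; last first.
    by rewrite aK.
  apply/negP => xa; have := a_min x; rewrite inE xA (K_low x a) // xa.
  by move/(_ isT).
pose A1 := [set x in A | d a x]; pose B := [set x in A | (x != a) && ~~ d a x].
have A1A: {subset A1 <= A} by move=> x; rewrite inE => /andP[].
have BA: {subset B <= A} by move=> x; rewrite inE => /andP[].
have aA1: a \notin A1 by rewrite inE d_irr andbF.
have aB: a \notin B by rewrite inE eqxx andbF.
have A1B: {in A1, forall x, x \notin B}.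
  by move=> x; rewrite !inE => /andP[_ ->]; rewrite !andbF.
have AE x : (x \in A) = [|| x == a, x \in A1 | x \in B].
  rewrite !inE; case: eqVneq => [->|_] //=; rewrite ?aA //.
  by case: (d a x); rewrite ?andbT ?andbF ?orbF.
have small (C : {set T}) : {subset C <= A} -> a \notin C -> #|C| < n.
  move=> CA aC; apply: leq_trans leAn; apply: proper_card; apply/properP.
  by split; [apply/subsetP | exists a].
have [|||X1 [X2 [uX1 uX2 X1E X2E Xalt]]] := IHn A1; first exact: small.
- by move=> x y z /A1A xA /A1A yA /A1A zA; apply: forestA.
- by move=> x c /A1A xA; apply: K_low.
have [|||Y1 [Y2 [uY1 uY2 Y1E Y2E Yalt]]] := IHn B; first exact: small.
- by move=> x y z /BA xA /BA yA /BA zA; apply: forestA.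
- by move=> x c /BA xA; apply: K_low.
(* If [a] is in [K], the elements of [K] in [A] are comparable to [a], hence outside [B]; otherwise
   [K] misses [A]. So each letter of [B] is written twice. *)
have BK: {in B, forall b, b \notin K}.
  move=> b bB; have [aK'|/aK] := boolP (a \in K); last by apply; apply: BA.
  apply/negP => /(K_chain a b aK'); have := bB.
  rewrite inE => /and3P[bA neq_ba].
  by rewrite eq_sym (negPf neq_ba) (negPf (a_min b bA)) orbF => /negPf ->.
(* An element of [B] below a descendant of [a] would be comparable to [a] by the forest property. *)
have B_inc x b : b \in B -> (x == a) || (x \in A1) -> d x b || d b x = false.
  move=> bB xa; have := bB; rewrite inE => /and3P[bA neq_ba ab].
  case/orP: xa => [/eqP ->|]; first by rewrite (negPf ab) (negPf (a_min b bA)).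
  rewrite inE => /andP[xA ax]; apply/norP; split.
    by apply: contra ab; apply: d_tr.
  apply/negP => bx; have := forestA a b x aA bA xA ax bx.
  by rewrite eq_sym (negPf neq_ba) (negPf ab) (negPf (a_min b bA)).
pose a1 := if a \in K then [::] else [:: a].
have a1E x : x \in a1 = (x == a) && (a \notin K).
  by rewrite /a1; case: (a \in K); rewrite ?inE ?andbT ?andbF.
exists (a1 ++ X1 ++ Y1), (Y2 ++ a :: X2); split.
- rewrite !cat_uniq uX1 uY1 /= andbT; apply/and3P; split.
  + by rewrite /a1; case: ifP.
  + apply/hasPn => x; rewrite mem_cat X1E Y1E !inE a1E.
    by case: eqP => //= ->; rewrite d_irr !andbF.
  + apply/hasPn => x; rewrite Y1E X1E !inE => /and3P[_ _ /andP[_ /negPf ->]].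
    by rewrite !andbF.
- rewrite cat_uniq uY2 /= uX2 X2E (negPf aA1) Y2E (negPf aB) /= andbT.
  by apply/hasPn => x; rewrite X2E Y2E; apply: A1B.
- move=> x; rewrite !mem_cat a1E X1E Y1E !in_setD AE.
  case: eqVneq => [->|_] /=; last by rewrite -andb_orr.
  by rewrite (negPf aA1) (negPf aB) !andbF !orbF andbT.
- move=> x; rewrite mem_cat inE Y2E X2E AE.
  by do ![case: (_ \in _); rewrite ?orbT //=].
have aX1: a \notin X1 by rewrite X1E in_setD (negPf aA1) andbF.
have aY1: a \notin Y1 by rewrite Y1E in_setD (negPf aB) andbF.
have aX2: a \notin X2 by rewrite X2E.
have aY2: a \notin Y2 by rewrite Y2E.
have XB x : x \in B -> x \notin X1 /\ x \notin X2.
  rewrite X1E X2E in_setD => xB.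
  have /negPf -> : x \notin A1 by apply: contraL xB; apply: A1B.
  by rewrite andbF.
have YA x : x \in A1 -> x \notin Y1 /\ x \notin Y2.
  by rewrite Y1E Y2E in_setD => /A1B /negPf ->; rewrite andbF.
(* The restriction is [axax] if [a] is not in [K], and [xax] or [ax] if it is. The bad case [aax]
   would need [x] in [K] but not [a], which [aK] excludes. *)
have altA1 : {in A1, forall x,
    alternate a x ((a1 ++ X1 ++ Y1) ++ Y2 ++ a :: X2)}.
  move=> x xA1; have [xY1 xY2] := YA x xA1.
  have neq_ax: a != x by apply: contraNneq aA1 => ->.
  rewrite alternateE // !restr_cat (restr_nil aY1) // (restr_nil aY2) //.
  rewrite /= !inE eqxx /= -/(restr a x X2) (restrC a x X1) (restrC a x X2).
  rewrite (restr_single _ uX1 aX1) // (restr_single _ uX2 aX2) //.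
  rewrite X1E X2E in_setD xA1 andbT.
  rewrite /a1; case: ifPn => aK' /=.
    by case: ifP => /=; rewrite ?eqxx ?(eq_sym x) neq_ax.
  by rewrite (aK aK' x) ?A1A //= ?inE ?eqxx /= (eq_sym x) neq_ax.
(* The copies of [b] in [Y1] and [Y2] have no [x] between them, so the restriction contains [bb]. *)
have altB x b : b \in B -> (x == a) || (x \in A1) ->
    alternate x b ((a1 ++ X1 ++ Y1) ++ Y2 ++ a :: X2) = false.
  move=> bB xA1; have [bX1 bX2] := XB b bB.
  have neq_ba: b != a by apply: contraNneq aB => <-.
  have xB: x \notin B by case/orP: xA1 => [/eqP -> //|]; apply: A1B.
  have neq_xb: x != b by apply: contraNneq xB => ->.
  have bY: (b \in Y1) && (b \in Y2) by rewrite Y1E Y2E inE bB BK.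
  case/andP: bY => bY1 bY2.
  have xY1: x \notin Y1 by rewrite Y1E in_setD (negPf xB) andbF.
  have xY2: x \notin Y2 by rewrite Y2E.
  rewrite alternateE // !restr_cat (restrC _ _ Y1) (restrC _ _ Y2).
  rewrite (restr_single _ uY1 xY1) (restr_single _ uY2 xY2) // bY1 bY2.
  by rewrite -!catA /= catA sorted_cat_cons /= eqxx !andbF.
move=> x y; rewrite !AE => xA yA neq_xy.
case/or3P: xA => xA; case/or3P: yA => yA.
- by rewrite (eqP xA) (eqP yA) eqxx in neq_xy.
- by rewrite (eqP xA) altA1 //; move: yA; rewrite inE => /andP[_ ->].
- by rewrite altB ?xA // B_inc ?xA.
- by rewrite (eqP yA) alternateC altA1 //; move: xA;
    rewrite inE => /andP[_ ->]; rewrite orbT.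
- have [[xY1 xY2] [yY1 yY2]] := (YA x xA, YA y yA).
  rewrite -Xalt // !alternateE // !restr_cat.
  rewrite (restr_nil xY1) // (restr_nil xY2) //=.
  have [ax ay]: a != x /\ a != y by split; apply: contraNneq aA1 => ->.
  rewrite !inE (negPf ax) (negPf ay) /= cats0 (_ : restr x y a1 = [::]) //.
  by rewrite restr_nil // a1E negb_and eq_sym ?ax ?ay.
- by rewrite altB ?xA ?orbT // B_inc ?xA ?orbT.
- by rewrite alternateC altB ?yA // orbC B_inc ?yA.
- by rewrite alternateC altB ?yA ?orbT // orbC B_inc ?yA ?orbT.
- have [[xX1 xX2] [yX1 yX2]] := (XB x xA, XB y yA).
  rewrite -Yalt // !alternateE // !restr_cat.
  have [ax ay]: a != x /\ a != y by split; apply: contraNneq aB => ->.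
  rewrite (restr_nil xX1) //= !inE (negPf ax) (negPf ay) /=.
  rewrite -/(restr x y X2) (restr_nil xX2) // cats0
    (_ : restr x y a1 = [::]) //.
  by rewrite restr_nil // a1E negb_and eq_sym ?ax ?ay.
Qed.
End Forest.

(** * Chains in an order with acyclic Hasse diagram *)

Section Hasse.
Variables (T : finType) (d : rel T).
Hypotheses (d_irr : irreflexive d) (d_tr : transitive d).
Implicit Types (x y z : T) (p : seq T).

(** Induction on the number of elements strictly between [x] and [y]: splitting at one of them
    leaves fewer on each side. *)
Lemma saturated_chain x y : d x y -> exists p, path (covers d) x (rcons p y).
Proof.
have [n] := ubnP #|[set z | d x z && d z y]|; elim: n x y => // n IHn x y.
rewrite ltnS => le_n xy.
have [/existsP[z /andP[xz zy]]|Nxy] :=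
  boolP [exists z, d x z && d z y]; last first.
  by exists [::]; rewrite /covers /= xy Nxy.
have [|//|p pP] := IHn x z.
  apply: leq_trans le_n; apply: proper_card; apply/properP; split.
    by apply/subsetP => t; rewrite !inE => /andP[-> /d_tr ->].
  by exists z; rewrite !inE ?d_irr ?xz ?zy ?andbF.
have [|//|q qP] := IHn z y.
  apply: leq_trans le_n; apply: proper_card; apply/properP; split.
    by apply/subsetP => t; rewrite !inE => /andP[/(d_tr xz) -> ->].
  by exists z; rewrite !inE ?d_irr ?xz ?zy ?andbF.
by exists (rcons p z ++ q); rewrite rcons_cat cat_path pP last_rcons.
Qed.

(** Two saturated chains are joined at [x]; by transitivity all pairs along the result are related
    by [d]. Such a [p] is one side of the cycle built below. *)
Lemma saturated_chain_through x m M : d m x -> d x M ->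
  exists p, [/\ path (covers d) m (rcons p M), x \in p, uniq p,
    {in p, forall t, d m t /\ d t M} &
    {in p, forall t, [|| t == x, d t x | d x t]}].
Proof.
move=> /saturated_chain[p1 p1P] /saturated_chain[p2 p2P].
have covd : subrel (covers d) d by move=> y z /andP[].
have pairs y z p : path (covers d) y (rcons p z) -> pairwise d (y :: rcons p z).
  by move/(sub_path covd) => pP; rewrite -sorted_pairwise.
have pP: path (covers d) m (rcons (p1 ++ x :: p2) M).
  by rewrite -cat_rcons rcons_cat cat_path p1P last_rcons.
exists (p1 ++ x :: p2); split=> //.
- by rewrite mem_cat mem_head orbT.
- move/pairs: (pP); rewrite pairwise_cons pairwise_rcons => /and3P[_ _].
  by rewrite -sorted_pairwise //; apply: sorted_uniq.
- move=> t tp; move/pairs: (pP).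
  rewrite pairwise_cons pairwise_rcons all_rcons => /and3P[/andP[_ /allP mp]].
  by move=> /allP pM _; rewrite mp // pM.
- move/pairs: p1P; rewrite pairwise_cons pairwise_rcons.
  case/and3P => _ /allP p1x _.
  move/pairs: p2P; rewrite pairwise_cons all_rcons.
  case/andP => /andP[_ /allP p2x] _ t.
  by rewrite mem_cat inE => /or3P[/p1x|/eqP|/p2x] ->; rewrite ?eqxx ?orbT.
Qed.

Lemma acyclic_interval_chain r x y z : acyclic (hasse d) ->
  d r x -> d r y -> d x z -> d y z -> [|| x == y, d x y | d y x].
Proof.
move=> acyc rx ry xz yz; apply: contraT => /norP[neq_xy /norP[Nxy Nyx]].
(* With [m] maximal below [x], [y] and [M] minimal above them, saturated
   chains from [m] to [M] through [x] and through [y] meet only at their ends. *)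
have [|m + m_max] := @minimal_elt T (fun u v => d v u) d_irr
    (fun v u w vu uw => d_tr uw vu) [set m | d m x && d m y].
  by apply/set0Pn; exists r; rewrite inE rx.
rewrite inE => /andP[mx my].
have [|M + M_min] := minimal_elt d_irr d_tr (A := [set M | d x M && d y M]).
  by apply/set0Pn; exists z; rewrite inE xz.
rewrite inE => /andP[xM yM].
have [p [pP xp up p_in p_x]] := saturated_chain_through mx xM.
have [q [qP yq uq q_in q_y]] := saturated_chain_through my yM.
(* A common element above both [x] and [y] contradicts the minimality of [M], one below both the
   maximality of [m]; in all other cases [x] and [y] are equal or comparable. *)
have pq t : t \in p -> t \notin q.
  move=> tp; apply/negP => tq; have [mt tM] := p_in t tp.
  case/or3P: (p_x t tp) => [/eqP tx|tx|xt];
    case/or3P: (q_y t tq) => [/eqP ty|ty|yt].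
  - by rewrite -tx ty eqxx in neq_xy.
  - by rewrite -tx ty in Nxy.
  - by rewrite -tx yt in Nyx.
  - by rewrite -ty tx in Nyx.
  - by have := m_max t; rewrite inE tx ty mt; move/(_ isT).
  - by rewrite (d_tr yt tx) in Nyx.
  - by rewrite -ty xt in Nxy.
  - by rewrite (d_tr xt ty) in Nxy.
  - by have := M_min t; rewrite inE xt yt tM; move/(_ isT).
have covh : subrel (covers d) (hasse d) by move=> u v uv; apply/orP; left.
have hassC u v : hasse d u v = hasse d v u by apply: orbC.
(* Up along [p], down along [q]. Since [p] contains [x], the cycle has at least three vertices. *)
case: (acyc (m :: p ++ M :: rev q)).
  by case: (p) xp => //= *; rewrite size_cat /= addnS.
apply/andP; split.
  rewrite /cycle rcons_cat rcons_cons -cat_rcons cat_path last_rcons.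
  rewrite (sub_path covh pP) -rev_cons.
  have := rev_path (hasse d) m (rcons q M).
  rewrite last_rcons belast_rcons => ->.
  by rewrite (eq_path (e' := hasse d)) ?(sub_path covh qP).
have mM := d_tr mx xM.
have mNp: m \notin p by apply/negP => /p_in[]; rewrite d_irr.
have MNp: M \notin p by apply/negP => /p_in[_]; rewrite d_irr.
have mNq: m \notin q by apply/negP => /q_in[]; rewrite d_irr.
have MNq: M \notin q by apply/negP => /q_in[_]; rewrite d_irr.
have neq_mM: m != M by apply: contraTneq mM => ->; rewrite d_irr.
rewrite cons_uniq mem_cat inE mem_rev !negb_or mNp neq_mM mNq cat_uniq up.
rewrite cons_uniq mem_rev MNq rev_uniq uq !andbT; apply/hasPn => t.
by rewrite inE mem_rev => /predU1P[-> //|]; apply: contraL; apply: pq.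
Qed.

Lemma half_words r (K A : {set T}) : acyclic (hasse d) ->
  (forall v, [|| v == r, d r v | d v r]) ->
  {in K &, forall x y, [|| x == y, d x y | d y x]} ->
  (forall x, {in K, forall c, [|| x == c, d x c | d c x]} -> x \in K) ->
  {in A, forall x, (x == r) || d r x} ->
  exists X1 X2, [/\ uniq X1, uniq X2, X1 =i A :\: K, X2 =i A &
    {in A &, forall x y, x != y ->
       alternate x y (X1 ++ X2) = d x y || d y x}].
Proof.
move=> acyc r_univ K_chain K_max rA.
have forest x y z : (x == r) || d r x -> (y == r) || d r y ->
    d x z -> d y z -> [|| x == y, d x y | d y x].
  case/orP => [/eqP ->|rx]; first by rewrite eq_sym => /orP[] ->; rewrite ?orbT.
  case/orP => [/eqP ->|ry]; first by rewrite rx !orbT.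
  exact: acyclic_interval_chain rx ry.
apply: forest_words => // [x y z xA yA _|x c xA cK xc].
  by apply: forest; apply: rA.
(* An [x] below [c] in [K] is comparable to every [c'] in [K]: through [r] if [c'] is below [r],
   through [c] if [c'] is [c] or above it, and by the forest property if [c'] lies between [r] and
   [c]. *)
apply: K_max => c' c'K; have [c'r|c'Nr] := boolP (d c' r).
  by case/orP: (rA x xA) => [/eqP -> | /(d_tr c'r) ->]; rewrite ?c'r !orbT.
have rc' : (c' == r) || d r c'.
  by have := r_univ c'; rewrite (negPf c'Nr) orbF.
case/or3P: (K_chain c c' cK c'K) => [/eqP <-|cc'|c'c].
- by rewrite xc orbT.
- by rewrite (d_tr xc cc') orbT.
- by apply: forest xc c'c => //; apply: rA.
Qed.

End Hasse.

(** Transfers acyclicity to the reversed order, so that [half_words] also handles the elements below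
    [r]. *)
Lemma hasse_dual (T : finType) (d : rel T) :
  hasse [rel x y | d y x] =2 hasse d.
Proof.
have covE x y : covers [rel x y | d y x] x y = covers d y x.
  rewrite /covers /=; congr (_ && ~~ _).
  by apply: eq_existsb => z; rewrite andbC.
by move=> x y; rewrite [LHS]orbC; congr (_ || _); apply: covE.
Qed.

(** * Merging the words of the two halves *)

Section UpperBound.
Variables (T : finType) (e : rel T).

Lemma double_arborescence_representant : simple_graph e ->
  double_arborescence e ->
  exists2 w, word_representant e w & size w = 2 * #|T| - clique_number e.
Proof.
move=> [e_sym e_irr] [[d [ed d_anti d_tr] [_ _ acyc]] [r rP]].
have d_irr : irreflexive d.
  by move=> x; apply/negP => xx; have := d_anti x x; rewrite xx.
have r_univ v : [|| v == r, d r v | d v r].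
  by have := in_setT v; rewrite rP !inE ed.
have [K cK sizeK] := clique_number_witness e.
have K_chain : {in K &, forall x y, [|| x == y, d x y | d y x]}.
  move=> x y xK yK; case: eqVneq => //= neq_xy; rewrite -ed.
  by have /forall_inP/(_ x xK)/forall_inP/(_ y yK)/implyP := cK; apply.
(* Otherwise [x |: K] would be a clique larger than the maximum. *)
have K_max x : {in K, forall c, [|| x == c, d x c | d c x]} -> x \in K.
  move=> xK; apply: contraT => xNK.
  suff /clique_leq: clique e (x |: K) by rewrite -sizeK cardsU1 xNK ltnn.
  apply/forall_inP => a /setU1P aK; apply/forall_inP => b /setU1P bK.
  apply/implyP => neq_ab; rewrite ed; move: neq_ab.
  case: aK bK => [->|aK] [->|bK]; first by rewrite eqxx.
  - by move/negPf => E; have := xK b bK; rewrite E.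
  - by rewrite eq_sym orbC => /negPf E; have := xK a aK; rewrite E.
  - by move/negPf => E; have := K_chain a b aK bK; rewrite E.
pose d' := [rel x y | d y x].
have d'_irr : irreflexive d' by [].
have d'_tr : transitive d' by move=> y x z /= yx zy; apply: d_tr yx.
have acyc' : acyclic (hasse d').
  move=> c c2 /andP[cyc uc]; apply: (acyc c c2); rewrite /ucycle uc andbT.
  by rewrite -(eq_cycle (hasse_dual d)).
pose U := [set v | (v == r) || d r v].
have [|X1 [X2 [uX1 uX2 X1E X2E Xalt]]] :=
  half_words (A := U) d_irr d_tr acyc r_univ K_chain K_max.
  by move=> x; rewrite inE.
(* As [r] belongs to [U], the complement consists of the elements strictly below [r], which lie
   above [r] in [d']. *)
have [||||Y1 [Y2 [uY1 uY2 Y1E Y2E Yalt]]] :=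
  half_words (r := r) (K := K) (A := ~: U) d'_irr d'_tr acyc'.
- by move=> v; rewrite /= [d v r || _]orbC.
- by move=> x y xK yK; rewrite /= [d y x || _]orbC; apply: K_chain.
- move=> x xK; apply: K_max => c /xK; rewrite /= [d c x || _]orbC; exact.
- move=> x; rewrite !inE negb_or => /andP[xr rx].
  by have := r_univ x; rewrite (negPf xr) (negPf rx) => /= ->.
have memX x : x \in U -> [/\ x \in X2, x \notin Y1 & x \notin Y2].
  by move=> xU; rewrite X2E Y1E Y2E in_setD in_setC xU andbF.
have memY y : y \notin U -> [/\ y \in Y2, y \notin X1 & y \notin X2].
  by move=> yU; rewrite Y2E X1E X2E in_setD in_setC (negPf yU) andbF.
pose w := X1 ++ (rev Y2 ++ X2) ++ rev Y1.
have cross x y : x \in U -> y \notin U -> e x y = alternate x y w.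
  move=> xU yU; have [xX2 xY1 xY2] := memX x xU.
  have [yY2 yX1 yX2] := memY y yU.
  have neq_xy: x != y by apply: contraNneq yU => <-.
  have yx : d y x.
    move: xU yU; rewrite !inE negb_or => rx /andP[yr Nry].
    have yr' : d y r by have := r_univ y; rewrite (negPf yr) (negPf Nry).
    by case/orP: rx => [/eqP -> //|/(d_tr _ _ _ yr')].
  rewrite ed yx orbT alternateE // !restr_cat !restr_rev.
  rewrite (restr_single _ uX1 yX1) (restr_single _ uX2 yX2) xX2.
  rewrite ![restr x y _]restrC (restr_single _ uY1 xY1)
    (restr_single _ uY2 xY2) yY2.
  by case: ifP; case: ifP; rewrite /= ?(eq_sym y) neq_xy.
exists w.
  split=> [a|x y neq_xy].
    rewrite !mem_cat !mem_rev X2E Y2E in_setC.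
    by case: (a \in U); rewrite ?orbT.
  have [xU|xU] := boolP (x \in U); have [yU|yU] := boolP (y \in U).
  - have [[_ xY1 xY2] [_ yY1 yY2]] := (memX x xU, memX y yU).
    rewrite ed -Xalt // !alternateE // !restr_cat !restr_rev.
    by rewrite (restr_nil xY1) // (restr_nil xY2) // cats0.
  - exact: cross.
  - by rewrite e_sym alternateC; apply: cross.
  - have [[_ xX1 xX2] [_ yX1 yX2]] := (memY x xU, memY y yU).
    (* For two letters below [r], only [rev Y2 ++ rev Y1] remains, the reverse of [Y1 ++ Y2]. *)
    rewrite ed orbC -[_ || _]Yalt ?in_setC // -alternate_rev // rev_cat.
    rewrite !alternateE // !restr_cat (restr_nil xX1) // (restr_nil xX2) //.
    by rewrite cats0.
(* [X2] and [Y2] together list every vertex once, [X1] and [Y1] every vertex outside [K] once. *)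
rewrite !size_cat !size_rev -!(card_uniqP _) //.
rewrite (eq_card X1E) (eq_card X2E) (eq_card Y1E) (eq_card Y2E) -sizeK.
have ->: #|U :\: K| + (#|~: U| + #|U| + #|~: U :\: K|) = #|T| + #|~: K|.
  rewrite -(cardsC U) -(cardsID U (~: K)) setIC -setDE.
  by rewrite (setDE (~: K)) (setDE (~: U)) (setIC (~: U)) addnCA
    [#|~: U| + #|U|]addnC.
by rewrite mul2n -addnn -addnBA ?max_card // -(cardsC K) addKn.
Qed.

End UpperBound.

Theorem theorem9 (T : finType) (e : rel T) (n k : nat) :
  simple_graph e -> double_arborescence e ->
  #|T| = n -> clique_number e = k ->
  min_representant_length e (2 * n - k).
Proof.
move=> e_simple e_arb <- <-; split; last by move=> w; apply: representant_size.
exact: double_arborescence_representant.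
Qed.
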